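(* Let $G$ be a connected finite graph on at least three vertices such that every ball of radius $3$ in $G$ is $2$-connected and $d(u)\ge \frac13\bigl(|M_3(v)|+\kappa(G_3(v))\bigr)$ for every vertex $v\in V(G)$ and for every interior vertex $u$ of $G_3(v)$. Then $G$ is Hamiltonian.
   Context: Graphs have no loops or multiple edges; $d(w)$ is the degree of $w$. $M_r(u)$ is the set of vertices at distance at most $r$ from $u$, and the ball $G_r(u)$ is the subgraph induced by $M_r(u)$. A vertex $w$ of $G_r(u)$ is an interior vertex of $G_r(u)$ if the ball $G_1(w)$ is a subgraph of $G_r(u)$. $\kappa(H)$ is the smallest number of vertices whose removal turns $H$ into a disconnected or trivial graph. A finite graph is Hamiltonian if it has a cycle through all its vertices. *)

(* Defs.v *)
From mathcomp Require Import all_boot all_order all_algebra.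

Set Implicit Arguments.
Unset Strict Implicit.
Unset Printing Implicit Defensive.

(* A graph is a symmetric irreflexive relation e on a finType T.  An induced
   subgraph is represented by its vertex set A : {set T}. *)
Section Graph.

Variables (T : finType) (e : rel T).

Definition degree (w : T) : nat := #|[set x | e w x]|.

Definition induced (A : {set T}) : rel T :=
  [rel x y | [&& x \in A, y \in A & e x y]].

Definition subgraph (A B : {set T}) : Prop :=
  A \subset B /\ subrel (induced A) (induced B).

Definition connected (A : {set T}) : bool :=
  [forall x in A, forall y in A, connect (induced A) x y].

(* M_r(u); a shortest walk is a path, so distance at most r amounts to the
   existence of a walk with at most r edges. *)
Definition ball (r : nat) (u : T) : {set T} :=
  [set w | [exists k : 'I_r.+1, exists p : k.-tuple T,
              path e u p && (last u p == w)]].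

Definition interior (r : nat) (u w : T) : Prop :=
  w \in ball r u /\ subgraph (ball 1 w) (ball r u).

(* Allowing the empty graph next to the one-vertex graph does not change the
   minimum when A is nonempty, and makes S = A always admissible. *)
Definition disconnecting (A S : {set T}) : bool :=
  (S \subset A) && (~~ connected (A :\: S) || (#|A :\: S| <= 1)).

Definition kappa (A : {set T}) : nat :=
  #|[arg min_(S < A | disconnecting A S) #|S|]|.

Definition k_connected (k : nat) (A : {set T}) : bool := k <= kappa A.

(* The length bound excludes the degenerate cycles x and x, y, x, which ucycle
   admits. *)
Definition hamiltonian : Prop :=
  exists c : seq T, [/\ 2 < size c, ucycle e c & forall x, x \in c].

End Graph.

(* Main.v *)
Require Import Defs.
From mathcomp Require Import all_boot all_order all_algebra.
From mathcomp Require Import zify.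

(* Write B(m) for the ball of radius 3 around m, n_m for its size, k_m for its
   connectivity, and a+ for the successor of a on a longest cycle C, supposed
   not to be spanning.  Only k_m >= 2 and 3 d(u) >= n_m + k_m for u at distance
   at most 2 from m are used.
   1. If a, b are attachments of the same component K of G - C, rerouting
      through K gives a path from a+ to b+ longer than C; its ends admit no
      crossing pair of chords.  Counting N(x), N(a+), N(b+) (one of them
      shifted along the path) in B(a+), for x in K adjacent to a, shows that a
      successor on C can be exchanged for x without changing the length of C
      if x has two neighbours on C, and that all a+, b+ are far apart if no
      vertex of K has two neighbours on C.
   2. The far-apart case contradicts the 2-connectedness of balls, so every K
      has an x with two neighbours on C.  If K is not a single vertex, the
      exchange splits K into smaller components; in a minimal situation there
      are adjacent x, y in K without other neighbours off C, which is excluded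
      by a direct count.  Hence the vertices off C are pairwise nonadjacent.
   3. For x off C let I consist of x and the successors of its neighbours: an
      independent set of d(x)+1 vertices at mutual distance at most 2.  Choose
      m in I with k_m minimal and a minimum cut S of B(m).  Counting shows that
      all vertices of I - S lie in one component H of B(m) - S, and that any
      vertex y of another component is at distance 3 from m.  Comparing
      neighbourhoods in the balls around the other members of I, y has no
      neighbour in I by minimality of k_m, while it must have one by a count
      around a neighbour of x. *)

Set Implicit Arguments.
Unset Strict Implicit.
Unset Printing Implicit Defensive.

(** * Counting in a bounded set, and leaving a set along a walk *)

(** Inclusion-exclusion with the union bounded by [B]. Three sets of total size n + k in a ball of n
    vertices have overlap terms adding up to at least k; the degree hypothesis is mostly applied in
    this way. *)
Lemma card_union3 (T : finType) (X Y Z B : {set T}) :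
    X \subset B -> Y \subset B -> Z \subset B ->
  #|X| + #|Y| + #|Z| <= #|B| + #|X :&: Y| + #|(X :|: Y) :&: Z|.
Proof.
move=> XB YB ZB; rewrite -(cardsUI X Y) -addnA (addnC #|_ :&: _|) addnA.
rewrite -(cardsUI (X :|: Y) Z).
have: #|X :|: Y :|: Z| <= #|B| by rewrite subset_leq_card // !subUset XB YB.
lia.
Qed.

Lemma card_disjU (T : finType) (X Y : {set T}) :
  (forall w, w \in X -> w \in Y -> False) -> #|X :|: Y| = #|X| + #|Y|.
Proof.
move=> dXY; rewrite cardsU; suff -> : X :&: Y = set0 by rewrite cards0 subn0.
by apply/setP=> w; rewrite !inE; apply/negP=> /andP[]; apply: dXY.
Qed.

Lemma connect_exit (T : finType) (r : rel T) (Q : pred T) (x y : T) :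
  connect r x y -> Q x -> ~~ Q y -> exists u v, [/\ r u v, Q u & ~~ Q v].
Proof.
case/connectP=> p; elim: p x => [|z p IHp] x /=; first by move=> _ -> ->.
case/andP=> xz zp ylast Qx nQy.
by case: (boolP (Q z)) => Qz; [apply: IHp zp _ _ _ | exists x, z].
Qed.

(** * Balls, interior vertices and minimum cuts *)

Section Graph.

Variables (T : finType) (e : rel T).
Hypotheses (e_sym : symmetric e) (e_irr : irreflexive e).

Definition nbh (u : T) : {set T} := [set x | e u x].

Lemma nbhE (u w : T) : (w \in nbh u) = e u w.
Proof. by rewrite inE. Qed.

Lemma ballP (r : nat) (u w : T) :
  reflect (exists p, [/\ path e u p, last u p = w & size p <= r])
          (w \in ball e r u).
Proof.
rewrite inE; apply: (iffP existsP) => [[k /existsP[p /andP[up /eqP pw]]]|].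
  by exists p; rewrite size_tuple -ltnS.
case=> p [up pw sz]; have sz' : size p < r.+1 by [].
exists (Ordinal sz'); apply/existsP; exists (in_tuple p).
by rewrite /= up pw eqxx.
Qed.

Lemma ball_refl (r : nat) (u : T) : u \in ball e r u.
Proof. by apply/ballP; exists [::]. Qed.

Lemma ball_sym (r : nat) (u w : T) : (w \in ball e r u) = (u \in ball e r w).
Proof.
suff H v v' : v' \in ball e r v -> v \in ball e r v' by apply/idP/idP; exact: H.
case/ballP=> p [vp pv sz]; apply/ballP; exists (rev (belast v p)).
rewrite size_rev size_belast -pv rev_path (eq_path (e' := e)) //; split=> //.
by case: p {vp pv sz} => //= z p; rewrite rev_cons last_rcons.
Qed.

Lemma ball_trans (r s : nat) (u v w : T) :
  v \in ball e r u -> w \in ball e s v -> w \in ball e (r + s) u.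
Proof.
move=> /ballP[p [up pv sp]] /ballP[q [vq qw sq]]; apply/ballP; exists (p ++ q).
by rewrite cat_path last_cat size_cat up pv vq qw leq_add.
Qed.

Lemma ball_mono (r s : nat) (u w : T) :
  r <= s -> w \in ball e r u -> w \in ball e s u.
Proof.
by move=> rs /ballP[p [up pw sp]]; apply/ballP; exists p; rewrite (leq_trans sp).
Qed.

Lemma ball_edge (u w : T) : e u w -> w \in ball e 1 u.
Proof. by move=> uw; apply/ballP; exists [:: w]; rewrite /= uw. Qed.

Lemma ball0E (u w : T) : (w \in ball e 0 u) = (w == u).
Proof.
apply/ballP/eqP => [|->]; last by exists [::].
by case=> -[|v p] [].
Qed.

Lemma ball_edgeS (r : nat) (u v w : T) :
  v \in ball e r u -> e v w -> w \in ball e r.+1 u.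
Proof. by move=> uv /ball_edge vw; rewrite -addn1; apply: ball_trans uv vw. Qed.

Lemma edge_ballS (r : nat) (u v w : T) :
  e u v -> w \in ball e r v -> w \in ball e r.+1 u.
Proof. by move=> /ball_edge uv vw; rewrite -add1n; apply: ball_trans uv vw. Qed.

Lemma ballSP (r : nat) (u w : T) : w \in ball e r.+1 u ->
  w = u \/ exists2 v, e u v & w \in ball e r v.
Proof.
case/ballP=> [[|v p] /= [up pw sz]]; first by left.
by case/andP: up => uv vp; right; exists v => //; apply/ballP; exists p.
Qed.

Lemma ballSrP (r : nat) (u w : T) : w \in ball e r.+1 u ->
  w = u \/ exists2 v, v \in ball e r u & e v w.
Proof.
rewrite ball_sym => /ballSP[->|[v wv vu]]; first by left.
by right; exists v; rewrite 1?ball_sym // e_sym.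
Qed.

Lemma ball1P (u w : T) : w \in ball e 1 u -> w = u \/ e u w.
Proof.
by case/ballSP=> [->|[v uv]]; [left|rewrite ball0E => /eqP->; right].
Qed.

Lemma nbh_ball (r : nat) (u v : T) :
  v \in ball e r u -> nbh v \subset ball e r.+1 u.
Proof. by move=> uv; apply/subsetP=> w; rewrite inE; apply: ball_edgeS. Qed.

(** One more step from such a u stays within distance 3 of m, so the degree hypothesis covers every
    vertex at distance at most 2. *)
Lemma interior_ball2 (m u : T) : u \in ball e 2 m -> interior e 3 m u.
Proof.
move=> mu; have mu3 : u \in ball e 3 m by apply: ball_mono mu.
have sub : ball e 1 u \subset ball e 3 m.
  by apply/subsetP=> w uw; rewrite -[3]/(2 + 1); apply: ball_trans uw.
split=> //; split=> // x y /and3P[xB yB xy].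
by apply/and3P; rewrite (subsetP sub _ xB) (subsetP sub _ yB).
Qed.

Lemma connected_setD1 (B : {set T}) (x : T) :
  k_connected e 2 B -> x \in B -> connected e (B :\ x).
Proof.
move=> kB xB; apply: contraLR (kB) => nconn; rewrite -ltnNge ltnS /kappa.
case: arg_minnP => [|S _ minS].
  by rewrite /disconnecting subxx setDv cards0 orbT.
by rewrite -(cards1 x); apply: minS; rewrite /disconnecting sub1set xB nconn.
Qed.

(** The last alternative is the case of a minimum cut that leaves at most one vertex. *)
Lemma kappa_cut (B : {set T}) : exists2 S : {set T}, #|S| = kappa e B &
  S \subset B /\ (~~ connected e (B :\: S) \/ #|B| <= (kappa e B).+1).
Proof.
rewrite /kappa.
case: arg_minnP => [|S /andP[SB cutS] minS].
  by rewrite /disconnecting subxx setDv cards0 orbT.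
exists S => //; split=> //; case/orP: cutS => [|triv]; [by left|right].
by move: triv; rewrite cardsD (setIidPr SB); have := subset_leq_card SB; lia.
Qed.

End Graph.

(** * Successors and arcs on a cyclic sequence *)

Section Next.
Variable T : eqType.
Implicit Types (c p : seq T) (u v : T).

Lemma next_split c i p1 u v p2 :
  uniq c -> rot i c = p1 ++ u :: v :: p2 -> next c u = v.
Proof.
move=> Uc rc; rewrite -(next_rot i) // rc -(next_rot (size p1)) -?rc ?rot_uniq //.
by rewrite rc rot_size_cat /= eqxx.
Qed.

Lemma next_last c i v p : uniq c -> rot i c = v :: p -> next c (last v p) = v.
Proof.
move=> Uc rc; case/lastP: p rc => [|p u] rc /=.
  by rewrite -(next_rot i) // rc /= eqxx.
rewrite last_rcons -(next_rot i) // rc -(next_rot (size (v :: p))) -?rc ?rot_uniq //.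
by rewrite rc -rcons_cons -cats1 rot_size_cat /= eqxx.
Qed.

Lemma mem_split v (s : seq T) : v \in s -> exists l r, s = l ++ v :: r.
Proof. by case/splitPr=> l r; exists l, r. Qed.

Lemma arc_split c a b : uniq c -> a \in c -> b \in c -> a != b ->
  exists i p1 p2, [/\ rot i c = (next c a :: p1) ++ (next c b :: p2),
                      last (next c a) p1 = b & last (next c b) p2 = a].
Proof.
move=> Uc ca cb ab; case: (rot_to_arc Uc ca cb ab) => i q1 q2 _ _ rc.
have [j rj] : exists j, rot j c = rcons q1 b ++ rcons q2 a.
  by exists (rot_add c i 1); rewrite -rot_rot_add rc rot1_cons rcons_cat cat_rcons.
have [a' [p1 rp1]] : exists a' p1, rcons q1 b = a' :: p1.
  by case: q1 {rc rj} => [|v q]; [exists b, [::] | exists v, (rcons q b)].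
have [b' [p2 rp2]] : exists b' p2, rcons q2 a = b' :: p2.
  by case: q2 {rc rj} => [|v q]; [exists a, [::] | exists v, (rcons q a)].
have l1 : last a' p1 = b by rewrite -(last_cons b) -rp1 last_rcons.
have l2 : last b' p2 = a by rewrite -(last_cons a) -rp2 last_rcons.
have na : next c a = a'.
  by have := next_last Uc (etrans rj (congr1 (cat^~ _) rp1)); rewrite last_cat last_rcons.
have nb : next c b = b'.
  apply: (@next_split c j q1 b b' p2 Uc).
  by rewrite rj rp2 cat_rcons.
by exists j, p1, p2; rewrite na nb rj rp1 rp2.
Qed.

End Next.

(** * Rerouting a longest cycle through vertices off it *)

Section LongestCycle.
Variables (T : finType) (e : rel T).
Hypothesis e_sym : symmetric e.

Lemma path_rev v p : path e v p ->
  [/\ path e (last v p) (rev (belast v p)),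
      last (last v p) (rev (belast v p)) = v &
      rev (v :: p) = last v p :: rev (belast v p)].
Proof.
move=> vp; rewrite rev_path (eq_path (e' := e)) //; split=> //.
  by case: p {vp} => //= z p; rewrite rev_cons last_rcons.
by rewrite lastI rev_rcons.
Qed.

Variable c : seq T.
Hypotheses (cyc : ucycle e c)
  (cmax : forall c' : seq T, ucycle e c' -> size c' <= size c).

Let Uc : uniq c. Proof. by case/andP: cyc. Qed.

Lemma next_edge a : a \in c -> e a (next c a).
Proof. by case/andP: cyc => cc _; apply: next_cycle. Qed.

Definition offpath (k : T) (q : seq T) :=
  [&& path e k q, uniq (k :: q) & all (fun w => w \notin c) (k :: q)].

Definition off : rel T := induced e (~: [set x in c]).

Lemma offE x y : off x y = [&& x \notin c, y \notin c & e x y].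
Proof. by rewrite /off /induced /= !inE. Qed.

Lemma off_sym : symmetric off.
Proof. by move=> x y; rewrite !offE e_sym andbCA. Qed.

Lemma connect_off_notin k k' : k \notin c -> connect off k k' -> k' \notin c.
Proof.
move=> kc kk'; apply: contraT => k'c.
have [u [v []]] := connect_exit (Q := fun w => w \notin c) kk' kc k'c.
by rewrite offE => /and3P[_ ->].
Qed.

Lemma connect_offpath k k' : k \notin c -> connect off k k' ->
  exists2 q, offpath k q & last k q = k' /\ {in k :: q, forall w, connect off k w}.
Proof.
move=> kc /connectP[p kp ->]; case/shortenP: kp => q kq Uq _ {p}.
have kw : {in k :: q, forall w, connect off k w}.
  by move=> w wq; apply: (path_connect kq).
exists q => //; rewrite /offpath Uq (sub_path _ kq) /=; last first.
  by move=> x y; rewrite offE => /and3P[].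
rewrite kc /=; apply/allP=> w wq.
by apply: connect_off_notin (kw _ _); rewrite ?inE ?wq ?orbT.
Qed.

Lemma long_path_ends s p : path e s p -> uniq (s :: p) ->
  size c < size (s :: p) -> ~~ e s (last s p).
Proof.
move=> sp Up; apply: contraTN => st; rewrite -leqNgt; apply: cmax.
by rewrite /ucycle Up andbT /= rcons_path sp e_sym.
Qed.

Lemma long_path_off s p w : path e s p -> uniq (s :: p) ->
  size c < size (s :: p) -> w \notin s :: p -> ~~ (e s w && e (last s p) w).
Proof.
move=> sp Up szp wp; apply: contraL szp => /andP[sw tw]; rewrite -leqNgt.
apply: leq_trans (cmax (c' := w :: s :: p) _); first by [].
by rewrite /ucycle cons_uniq wp Up /= e_sym sw rcons_path sp tw.
Qed.

(** With t the last vertex, the chords sv and tu would close the path into the cycle s..u t..v s on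
    the same vertices. *)
Lemma long_path_crossing s p p1 u v p2 : path e s p -> uniq (s :: p) ->
  size c < size (s :: p) -> s :: p = p1 ++ u :: v :: p2 ->
  ~~ (e s v && e (last s p) u).
Proof.
move=> sp Up szp eqp; apply/negP=> /andP[sv tu].
have [r [eqr lr]] : exists r, rcons p1 u = s :: r /\ last s r = u.
  case: p1 eqp => [|x p1] [<- _]; first by exists [::].
  by exists (rcons p1 u); rewrite last_rcons.
have eqp' : p = r ++ v :: p2.
  by have: s :: p = s :: r ++ v :: p2; [rewrite eqp -cat_rcons eqr | case].
have lp : last s p = last v p2 by rewrite eqp' last_cat.
move: sp; rewrite eqp' cat_path lr /= => /and3P[sr uv vp2].
have [pth lst rv] := path_rev vp2.
have: size (s :: r ++ rev (v :: p2)) <= size c.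
  apply: cmax; rewrite /ucycle; apply/andP; split.
    rewrite /= rcons_cat cat_path sr lr rv /= rcons_path pth lst -lp.
    by rewrite e_sym tu e_sym sv.
  have : perm_eq (s :: p) (s :: r ++ rev (v :: p2)).
    by rewrite perm_cons eqp' perm_cat2l perm_sym perm_rev.
  by move/perm_uniq <-.
by move: szp; rewrite eqp' /= !size_cat size_rev; lia.
Qed.

Lemma attachments_not_consecutive k q a : offpath k q -> a \in c ->
  e k a -> ~~ e (last k q) (next c a).
Proof.
case/and3P=> kq Uq /allP qc ca ka; apply/negP=> k'a.
case: (rot_to ca) => i p rc.
have Up : uniq (a :: p) by rewrite -rc rot_uniq.
have mp w : (w \in a :: p) = (w \in c) by rewrite -rc mem_rot.
have szp : size c = (size p).+1 by rewrite -(size_rot i) rc.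
have cp : cycle e (a :: p) by rewrite -rc rot_cycle; case/andP: cyc.
have: size (a :: (k :: q) ++ p) <= size c.
  apply: cmax; rewrite /ucycle; apply/andP; split.
    rewrite /= e_sym ka /= rcons_cat cat_path kq /=.
    move: k'a; rewrite -(next_rot i) // rc.
    case: p {rc Up mp szp} cp => [_|b p] /=; first by rewrite eqxx => ->.
    by rewrite eqxx => /andP[_ ->] ->.
  rewrite -cat_cons -cat1s -catA uniq_catCA cat_uniq cat1s Uq Up andbT.
  apply/hasPn=> w; rewrite mp => wc; apply: contraL wc; exact: qc.
by rewrite szp /= size_cat; lia.
Qed.

(** [S] is the arc from [next c a] to b. Running through it, then the detour k, q, then the other
    arc backwards gives a path to [next c b] longer than c, and the last three clauses say that it
    cannot be closed. The reversal of the second arc explains why the two crossing clauses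
    differ. *)
Lemma two_attachments_arcs k q a b : offpath k q -> a \in c -> b \in c ->
    a != b -> e k b -> e (last k q) a ->
    {in k :: q, forall w, ~~ e w (next c a)} ->
  exists S : {set T},
    [/\ [/\ next c a \in S, b \in S, next c b \notin S, a \notin S
           & S \subset [set x in c]],
        [/\ {in S, forall v, v != b -> next c v \in S}
          & {in c, forall v, v \notin S -> v != a -> next c v \notin S}],
        ~~ e (next c a) (next c b) /\
          (forall w, w \notin c -> ~~ (e (next c a) w && e (next c b) w)),
        {in S, forall v, v != b ->
           ~~ (e (next c a) (next c v) && e (next c b) v)}
      & {in c, forall v, v \notin S -> v != a ->
           ~~ (e (next c a) v && e (next c b) (next c v))}].
Proof.
case/and3P=> kq Uq /allP qc ca cb ab kb k'a qa'.
have [i [p1 [p2 [rc l1 l2]]]] := arc_split Uc ca cb ab.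
set a' := next c a in qa' rc l1 *; set b' := next c b in rc l2 *.
have U12 : uniq ((a' :: p1) ++ (b' :: p2)) by rewrite -rc rot_uniq.
have mc w : (w \in c) = (w \in a' :: p1) || (w \in b' :: p2).
  by rewrite -mem_cat -rc mem_rot.
have notS w : w \in b' :: p2 -> w \notin a' :: p1.
  by move: U12; rewrite cat_uniq => /and3P[_ /hasPn H _]; exact: H.
have inR w : w \in c -> w \notin a' :: p1 -> w \in b' :: p2.
  by rewrite mc => /orP[->|].
have szc : size c = size p1 + size p2 + 2.
  by rewrite -(size_rot i) rc size_cat /=; clear; lia.
have : cycle e ((a' :: p1) ++ (b' :: p2)) by rewrite -rc rot_cycle; case/andP: cyc.
rewrite /= rcons_cat cat_path /= l1 rcons_path l2 => /and4P[ap1 bb' bp2 aa'].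
have [rp rl re] := path_rev bp2.
pose p := p1 ++ (k :: q) ++ rev (b' :: p2).
have pP : path e a' p.
  by rewrite /p cat_path ap1 l1 /= e_sym kb cat_path kq re /= l2 k'a -l2.
have lp : last a' p = b' by rewrite /p !last_cat re /= rl.
have permp : perm_eq (a' :: p) ((k :: q) ++ (a' :: p1) ++ (b' :: p2)).
  rewrite /p -cat_cons perm_sym perm_catCA perm_cat2l perm_cat2l.
  by rewrite perm_sym perm_rev.
have Up : uniq (a' :: p).
  rewrite (perm_uniq permp) cat_uniq Uq U12 andbT.
  apply/hasPn=> w; rewrite mem_cat -mc => wc; apply: contraL wc; exact: qc.
have szp : size c < size (a' :: p).
  by rewrite (perm_size permp) 2!size_cat szc /=; clear; lia.
have nx1 l v w r : a' :: p1 = l ++ v :: w :: r -> next c v = w.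
  by move=> eqs; apply: (next_split Uc (i := i)); rewrite rc eqs -catA.
have nx2 l v w r : b' :: p2 = l ++ v :: w :: r -> next c v = w.
  by move=> eqs; apply: (next_split Uc (i := i) (p1 := (a' :: p1) ++ l));
    rewrite rc eqs -catA.
have sp1 v : v \in a' :: p1 -> v != b -> exists l r, a' :: p1 = l ++ v :: next c v :: r.
  move=> vS vb; have [l [[|w r] def_p]] := mem_split vS.
    by move: vb; rewrite -l1 -(last_cons a') def_p last_cat eqxx.
  by exists l, r; rewrite def_p (nx1 _ _ _ _ def_p).
have sp2 v : v \in b' :: p2 -> v != a -> exists l r, b' :: p2 = l ++ v :: next c v :: r.
  move=> vS vb; have [l [[|w r] def_p]] := mem_split vS.
    by move: vb; rewrite -l2 -(last_cons b') def_p last_cat eqxx.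
  by exists l, r; rewrite def_p (nx2 _ _ _ _ def_p).
exists [set x in a' :: p1]; split.
- split; rewrite ?inE ?eqxx //.
  + by rewrite -l1 -in_cons mem_last.
  + by rewrite -in_cons; apply: notS; rewrite inE eqxx.
  + by rewrite -in_cons; apply: notS; rewrite -l2 mem_last.
  + by apply/subsetP=> x; rewrite !inE mc -in_cons => ->.
- split=> v.
    rewrite inE => vS vb; have [l [r eqs]] := sp1 v vS vb.
    by rewrite inE eqs mem_cat !inE eqxx !orbT.
  rewrite inE => vc vS va; have [l [r eqs]] := sp2 v (inR _ vc vS) va.
  by rewrite inE; apply: notS; rewrite eqs mem_cat !inE eqxx !orbT.
- split; first by have := long_path_ends pP Up szp; rewrite lp.
  (* Common neighbours on the detour are excluded by hypothesis; any other w off c lies off the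
     whole path. *)
  move=> w wc; case: (boolP (w \in k :: q)) => wq.
    by rewrite e_sym (negbTE (qa' _ wq)).
  rewrite -lp; apply: long_path_off => //.
  by rewrite (perm_mem permp) mem_cat negb_or wq mem_cat -mc.
- move=> v; rewrite inE => vS vb; have [l [r eqs]] := sp1 v vS vb.
  rewrite -lp; apply: (long_path_crossing (p1 := l)
    (p2 := r ++ (k :: q) ++ rev (b' :: p2)) pP Up szp).
  by rewrite /p -cat_cons eqs -catA.
move=> v vc; rewrite inE => vS va; have [l [r eqs]] := sp2 v (inR _ vc vS) va.
rewrite -lp; apply: (long_path_crossing (p1 := (a' :: p1) ++ (k :: q) ++ rev r)
  (p2 := rev l) pP Up szp).
by rewrite /p eqs rev_cat !rev_cons -!cats1 -!catA.
Qed.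

(** The new cycle skips [next c z]: from the vertex after it along c to b, through k, q to z,
    backwards along c to [next c b], and back by the assumed chord. *)
Lemma cycle_exchange k q z b : offpath k q -> z \in c -> b \in c -> z != b ->
    e k b -> e (last k q) z -> ~~ e k (next c z) ->
    e (next c (next c z)) (next c b) ->
  exists c', [/\ ucycle e c', size c' = size c + size q
    & forall w, (w \in c') = (w \in k :: q) || (w \in c) && (w != next c z)].
Proof.
case/and3P=> kq Uq /allP qc cz cb; rewrite eq_sym => zb kb k'z.
have [i [p1 [p2 [rc l1 l2]]]] := arc_split Uc cb cz zb.
set b' := next c b in rc l1 *; set z' := next c z in rc l2 * => nkz'.
(* An empty arc would mean [next c z] = b, but k is adjacent to b only. *)
case: p2 => [|z'' p3] in rc l2 *; first by case/negP: nkz'; rewrite -l2 in kb.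
have -> : next c z' = z''.
  by apply: (next_split Uc (i := i) (p1 := b' :: p1) (p2 := p3)).
move=> z''b'.
have Ur : uniq ((b' :: p1) ++ (z' :: z'' :: p3)) by rewrite -rc rot_uniq.
have mc w : (w \in c) = (w \in b' :: p1) || (w \in z' :: z'' :: p3).
  by rewrite -mem_cat -rc mem_rot.
have szc : size c = size p1 + size p3 + 3.
  by rewrite -(size_rot i) rc size_cat /=; clear; lia.
have : cycle e ((b' :: p1) ++ (z' :: z'' :: p3)).
  by rewrite -rc rot_cycle; case/andP: cyc.
rewrite /= rcons_cat cat_path /= l1 rcons_path => /and5P[bp1 _ _ zp3 _].
have [rp rl re] := path_rev bp1; rewrite l1 in rp rl re.
pose c1 := (k :: q) ++ (b' :: p1) ++ (z'' :: p3).
exists ((z'' :: p3) ++ (k :: q) ++ rev (b' :: p1)).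
have perm1 : perm_eq ((z'' :: p3) ++ (k :: q) ++ rev (b' :: p1)) c1.
  by rewrite perm_catC -catA perm_cat2l perm_cat2r perm_rev.
have Ubz : uniq ((b' :: p1) ++ (z'' :: p3)) /\ z' \notin (b' :: p1) ++ (z'' :: p3).
  move: Ur; rewrite -[z' :: _]cat1s uniq_catCA cat1s cons_uniq.
  by case/andP=> -> ->.
have mem1 w : (w \in c1) = (w \in k :: q) || (w \in c) && (w != z').
  rewrite mem_cat mc mem_cat (in_cons z' (z'' :: p3)); congr (_ || _).
  case: eqP => [->|_]; last by rewrite andbT.
  by rewrite andbF -mem_cat (negbTE Ubz.2).
split.
- rewrite /ucycle (perm_uniq perm1) /c1 cat_uniq Uq Ubz.1 andbT; apply/andP; split.
    rewrite re /= rcons_cat cat_path zp3.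
    have -> : last z'' p3 = b by move: l2.
    rewrite /= e_sym kb rcons_cat cat_path kq /= k'z rcons_path rp rl.
    by rewrite e_sym.
  apply/hasPn=> w; rewrite mem_cat => wb; apply/negP=> /qc.
  by rewrite mc in_cons orbCA wb orbT.
- by rewrite (perm_size perm1) /c1 size_cat size_cat szc /=; clear; lia.
by move=> w; rewrite (perm_mem perm1) mem1.
Qed.

End LongestCycle.

(** * Counting in balls near a component off a longest cycle *)

Section LocalDegree.

Variables (T : finType) (e : rel T).
Hypotheses (e_sym : symmetric e) (e_irr : irreflexive e).

Notation B m := (ball e 3 m).
Notation kap m := (kappa e (ball e 3 m)).
Notation N := (nbh e).

Hypothesis kap2 : forall m, 2 <= kap m.
Hypothesis degN : forall m u, u \in ball e 2 m -> #|B m| + kap m <= 3 * #|N u|.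

Hypothesis conn : connected e [set: T].
Hypothesis connB : forall m w, w \in B m -> connected e (B m :\ w).

Section FixedCycle.

Variable c : seq T.
Hypotheses (cyc : ucycle e c)
  (cmax : forall c' : seq T, ucycle e c' -> size c' <= size c).

Let Uc : uniq c. Proof. by case/andP: cyc. Qed.

Notation nx := (next c).
Notation C := [set y in c].

Lemma memC w : (w \in C) = (w \in c).
Proof. by rewrite inE. Qed.

Let memE := (in_setU1, in_setU, in_setI, in_setD, in_set1, in_set0, nbhE, memC).

Lemma next_inj : injective nx.
Proof. exact: can_inj (prev_next Uc). Qed.

(** [connect] is reflexive on c as well, hence the explicit condition on x; the one on y follows. *)
Definition same_comp (x y : T) : bool := (x \notin c) && connect (off e c) x y.

Lemma same_comp_refl x : x \notin c -> same_comp x x.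
Proof. by rewrite /same_comp => ->; rewrite connect0. Qed.

Lemma same_comp_sym x y : same_comp x y = same_comp y x.
Proof.
suff H u v : same_comp u v -> same_comp v u by apply/idP/idP; apply: H.
case/andP=> uc uv; rewrite /same_comp (connect_off_notin uc uv).
by rewrite (sym_connect_sym (off_sym e_sym c)).
Qed.

Lemma same_comp_trans y x z : same_comp x y -> same_comp y z -> same_comp x z.
Proof.
move=> /andP[xc xy] /andP[_ yz]; rewrite /same_comp xc; exact: connect_trans yz.
Qed.

Lemma same_comp_edge x y z :
  same_comp x y -> e y z -> z \notin c -> same_comp x z.
Proof.
move=> xy yz zc; apply: same_comp_trans (xy) _.
have /andP[yc _] : same_comp y x by rewrite same_comp_sym.
by rewrite /same_comp yc connect1 // offE yc zc yz.
Qed.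

Lemma same_comp_offc x y : same_comp x y -> y \notin c.
Proof. by rewrite same_comp_sym => /andP[]. Qed.

Lemma same_comp_next x y a : same_comp x y -> a \in c -> e x a -> ~~ e y (nx a).
Proof.
case/andP=> xc xy ca xa; have [q offq [<- _]] := connect_offpath xc xy.
exact: attachments_not_consecutive cyc cmax _ _ _ offq ca xa.
Qed.

Lemma attachment_arcs x y a b : same_comp x y -> a \in c -> b \in c ->
    a != b -> e x a -> e y b ->
  exists S : {set T},
    [/\ [/\ nx a \in S, b \in S, nx b \notin S, a \notin S & S \subset C],
        [/\ {in S, forall v, v != b -> nx v \in S}
          & {in c, forall v, v \notin S -> v != a -> nx v \notin S}],
        ~~ e (nx a) (nx b) /\
          (forall w, w \notin c -> ~~ (e (nx a) w && e (nx b) w)),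
        {in S, forall v, v != b -> ~~ (e (nx a) (nx v) && e (nx b) v)}
      & {in c, forall v, v \notin S -> v != a ->
           ~~ (e (nx a) v && e (nx b) (nx v))}].
Proof.
move=> xy ca cb ab xa yb; have := xy; rewrite same_comp_sym => /andP[yc yx].
have [q offq [lq qw]] := connect_offpath yc yx.
apply: (two_attachments_arcs e_sym cyc cmax offq ca cb ab yb); rewrite ?lq //.
move=> w /qw yw; apply: same_comp_next ca xa.
by apply: same_comp_trans xy _; rewrite /same_comp yc.
Qed.

Lemma next_attachments_indep x y a b : same_comp x y -> a \in c -> b \in c ->
  e x a -> e y b -> ~~ e (nx a) (nx b).
Proof.
move=> xy ca cb xa yb; have [->|ab] := eqVneq a b; first by rewrite e_irr.
by have [S [_ _ []]] := attachment_arcs xy ca cb ab xa yb.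
Qed.

(* No successor of an attachment is adjacent to any vertex of this set, which
   therefore plays the role of an independent set of d(x)+1 vertices. *)
Definition succ_set x : {set T} := nx @: (N x :&: C) :|: (x |: (N x :\: C)).

Lemma card_succ_set x : x \notin c -> #|succ_set x| = #|N x|.+1.
Proof.
move=> xc; rewrite card_disjU => [|w /imsetP[z]]; last first.
  rewrite !inE => /andP[xz zc] ->; rewrite mem_next zc /= orbF => /eqP nzx.
  by rewrite -nzx mem_next zc in xc.
rewrite (card_imset _ next_inj) cardsU1 !inE e_irr andbF add1n addnS.
by rewrite cardsID.
Qed.

Lemma succ_set_ball x : succ_set x \subset ball e 2 x.
Proof.
apply/subsetP=> w; rewrite !memE => /orP[/imsetP[z]|].
  rewrite !memE => /andP[xz zc] ->.
  exact: (edge_ballS xz (ball_edge (next_edge cyc zc))).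
case/orP=> [/eqP->|/andP[_ xw]]; first exact: ball_refl.
by apply: ball_mono (ball_edge xw).
Qed.

Lemma succ_set_nbh x y a : same_comp x y -> a \in c -> e x a ->
  N (nx a) :&: succ_set y = set0.
Proof.
move=> xy ca xa; apply/setP=> w; rewrite !inE; apply/negP=> /andP[aw].
case/orP=> [/imsetP[z]|].
  rewrite !inE => /andP[yz zc] wz; move: aw; rewrite wz; apply/negP.
  exact: next_attachments_indep xy ca zc xa yz.
suff yw : same_comp x w -> False.
  case/orP=> [/eqP wy|/andP[wc yw']]; apply: yw; first by rewrite wy.
  exact: same_comp_edge xy yw' wc.
by move=> xw; have := same_comp_next xw ca xa; rewrite e_sym aw.
Qed.

(** Otherwise both neighbourhoods and [succ_set x], which has d(x)+1 elements, would be pairwise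
    disjoint in [B x] and too large together. *)
Lemma next_common_nbh x a b : x \notin c -> a \in c -> b \in c ->
  e x a -> e x b -> exists w, e (nx a) w /\ e (nx b) w.
Proof.
move=> xc ca cb xa xb; have xx := same_comp_refl xc.
have [/set0Pn[w]|] := boolP (N (nx a) :&: N (nx b) != set0).
  by rewrite !inE => /andP[]; exists w.
rewrite negbK => /eqP N0.
have na : nx a \in ball e 2 x := edge_ballS xa (ball_edge (next_edge cyc ca)).
have nb : nx b \in ball e 2 x := edge_ballS xb (ball_edge (next_edge cyc cb)).
have sub : succ_set x \subset B x.
  by apply: subset_trans (succ_set_ball x) _; apply/subsetP=> w; apply: ball_mono.
have := card_union3 (nbh_ball na) (nbh_ball nb) sub.
rewrite N0 setIUl !(succ_set_nbh xx) // setU0 cards0 card_succ_set //.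
have := degN na; have := degN nb; have := degN (ball_refl e 2 x); lia.
Qed.

Lemma next_ball2 x a b : x \notin c -> a \in c -> b \in c ->
  e x a -> e x b -> nx b \in ball e 2 (nx a).
Proof.
move=> xc ca cb xa xb; have [w [aw bw]] := next_common_nbh xc ca cb xa xb.
by apply: (edge_ballS aw); apply: ball_edge; rewrite e_sym.
Qed.

(** Let s, t be the ends of the rerouted path. The set [W] below collects shifted copies of N(s) and
    N(x) that avoid N(t); it has at least d(s)+d(x)-1 elements, so the three degrees sum to at most
    n+1 in the ball around s, whereas they sum to at least n+2. The last hypothesis keeps the copies
    disjoint from each other and from N(t). *)
Lemma shift_count x y a b : same_comp x y -> a \in c -> b \in c -> a != b ->
    e x a -> e y b -> nx b \in ball e 2 (nx a) ->
    (forall z, z \in c -> e x z -> z != a -> z != b ->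
       [/\ nx z \in ball e 2 (nx a), ~~ e (nx a) (nx (nx z))
         & ~~ e (nx b) (nx (nx z))]) ->
  False.
Proof.
move=> xy ca cb ab xa yb dab Hz.
have /andP[xc _] := xy; have xx := same_comp_refl xc.
have [S [[aS bS nbS naS SC] [nxS nxnS] [_ offs] cr1 cr2]] :=
  attachment_arcs xy ca cb ab xa yb.
have SC' w : w \in S -> w \in c by move/(subsetP SC); rewrite inE.
set s := nx a in aS offs cr1 cr2 dab Hz *; set t := nx b in nbS offs cr1 cr2 dab Hz *.
(* Neighbours of s move to their predecessors on the path: backwards along c on [S], forwards on the
   other arc. *)
pose X1 := [set v in S | (v != b) && e s (nx v)].
pose X2 := nx @: [set v in N s :&: C :\: S | v != a].
(* Neighbours of x move one step on [S] and two steps on the other arc, so that the vertex following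
   the image on the path is not adjacent to s. *)
pose M1 := nx @: [set z in N x :&: S | z != b].
pose M2 := nx @: (nx @: [set z in N x :&: C :\: S | z != a]).
pose O := N s :\: C.
pose Y := x |: (N x :\: C).
have memX1 v : v \in X1 -> [/\ v \in S, v != b & e s (nx v)].
  by rewrite inE => /and3P[].
have memX2 v : v \in X2 -> exists u, [/\ v = nx u, u \in c, u \notin S, u != a & e s u].
  by case/imsetP=> u; rewrite !inE => /andP[/and3P[? ? ?] ?] ->; exists u.
have memM1 v : v \in M1 -> exists z,
    [/\ v = nx z, z \in S, z != b, e x z &
        [/\ v \in ball e 2 s, ~~ e s (nx v) & ~~ e t (nx v)]].
  case/imsetP=> z; rewrite [z \in _]inE !memE => /andP[/andP[xz zS] zb] ->.
  exists z; split=> //.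
  by apply: Hz; rewrite ?SC' //; apply: contraNneq naS => <-.
have memM2 v : v \in M2 -> exists z,
    [/\ v = nx (nx z), z \in c, nx z \notin S, z != a &
     [/\ e x z, nx z \in ball e 2 s, ~~ e s v & ~~ e t v]].
  case/imsetP=> w /imsetP[z]; rewrite [z \in _]inE !memE.
  move=> /andP[/and3P[zS xz zc] za] -> ->.
  exists z; have zb : z != b by apply: contraNneq zS => ->.
  by have [? ? ?] := Hz z zc xz za zb; split=> //; apply: nxnS.
have s_indep z : z \in c -> e x z -> ~~ e s (nx z).
  by move=> zc xz; apply: next_attachments_indep xx ca zc xa xz.
have t_indep z : z \in c -> e x z -> ~~ e t (nx z).
  by move=> zc xz; apply: next_attachments_indep _ cb zc yb xz; rewrite same_comp_sym.
have xO w : w \in Y -> same_comp x w.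
  rewrite !inE => /orP[/eqP->//|/andP[wc xw]]; exact: same_comp_edge xx xw wc.
have sY w : w \in Y -> ~~ e s w.
  by move/xO=> xw; rewrite e_sym; apply: same_comp_next xw ca xa.
have tY w : w \in Y -> ~~ e t w.
  move/xO=> xw; rewrite e_sym; apply: same_comp_next cb yb.
  by apply: same_comp_trans xw; rewrite same_comp_sym.
have tc : t \in c by rewrite mem_next.
have sa : e s a by rewrite e_sym; apply: next_edge.
have dx : x \in ball e 2 s by apply: (edge_ballS sa); apply: ball_edge; rewrite e_sym.
have U1S w : w \in X1 :|: M1 -> w \in S.
  rewrite in_setU => /orP[/memX1[]//|/memM1[z [-> zS zb _ _]]].
  exact: nxS.
have U2c w : w \in X2 :|: (M2 :|: [set t]) -> (w \in c) && (w \notin S).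
  rewrite !in_setU in_set1.
  case/or3P=> [/memX2[u [-> uc uS ua _]]|/memM2[z [-> zc zS za [xz _ _ _]]]|/eqP->].
  - by rewrite mem_next uc nxnS.
  - rewrite !mem_next zc nxnS ?mem_next //.
    apply/eqP=> za'; have := same_comp_next xx zc xz; rewrite za' => /negP; exact.
  - by rewrite tc nbS.
have U3c w : w \in O :|: Y -> w \notin c.
  by rewrite in_setU => /orP[|/xO /same_comp_offc //]; rewrite !inE => /andP[].
pose W := (X1 :|: M1) :|: (X2 :|: (M2 :|: [set t])) :|: (O :|: Y).
have WN : W :&: N t = set0.
  apply/setP=> w; rewrite !memE; apply/negP=> /andP[+ tw].
  case/orP=> [/orP[/orP[/memX1[wS wb sw]|/memM1[z [wz zS _ xz _]]]|
      /or3P[/memX2[u [wu uc uS ua su]]|/memM2[z [_ _ _ _ [_ _ _ /negP[]//]]]|/eqP wt]]|].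
  - by have := cr1 w wS wb; rewrite sw tw.
  - by have := t_indep z (SC' _ zS) xz; rewrite -wz tw.
  - by have := cr2 u uc uS ua; rewrite su -wu tw.
  - by rewrite wt e_irr in tw.
  case/orP=> [/andP[wc sw]|wY]; first by have := offs w wc; rewrite sw tw.
  by have := tY w; rewrite !memE wY tw => /(_ isT).
have WB : W \subset B s.
  apply/subsetP=> w; rewrite !in_setU in_set1.
  case/orP=> [/orP[/orP[/memX1[wS wb sw]|/memM1[z [_ _ _ _ [d1 _ _]]]]|
      /or3P[/memX2[u [wu uc uS ua su]]|/memM2[z [-> zc _ _ [_ dz _ _]]]|/eqP->]]|
      /orP[]].
  - apply: ball_mono (edge_ballS sw (ball_edge _)) => //.
    by rewrite e_sym; apply: next_edge; rewrite ?SC'.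
  - exact: ball_mono d1.
  - rewrite wu; apply: ball_mono (edge_ballS su (ball_edge _)) => //.
    exact: next_edge.
  - by apply: ball_edgeS dz _; apply: next_edge; rewrite ?mem_next.
  - exact: ball_mono dab.
  - by rewrite !memE => /andP[_ /ball_edge]; apply: ball_mono.
  rewrite !memE => /orP[/eqP->|/andP[_ xw]]; first exact: ball_mono dx.
  by apply: (subsetP (nbh_ball dx)); rewrite nbhE.
have := card_union3 WB (nbh_ball dab) (sub0set _).
rewrite WN setI0 !cards0.
have c1 : #|X1 :|: M1| = #|X1| + #|M1|.
  by apply: card_disjU => w /memX1[_ _ sw] /memM1[z [_ _ _ _ [_ /negP[]]]].
have c2 : #|M2 :|: [set t]| = #|M2| + 1.
  rewrite card_disjU ?cards1 // => w /memM2[z [-> zc zS za _]].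
  rewrite in_set1 => /eqP /next_inj zb'.
  by rewrite zb' bS in zS.
have c3 : #|X2 :|: (M2 :|: [set t])| = #|X2| + (#|M2| + 1).
  rewrite card_disjU ?c2 // => w /memX2[u [wu uc uS ua su]].
  rewrite in_setU in_set1 wu.
  case/orP=> [/memM2[z [/next_inj uz zc zS za [xz _ _ _]]]|/eqP /next_inj ub].
    by have := s_indep z zc xz; rewrite -uz su.
  by rewrite ub bS in uS.
have c4 : #|O :|: Y| = #|O| + #|Y|.
  by apply: card_disjU => w; rewrite in_setD nbhE => /andP[_ sw] /sY; rewrite sw.
have -> : #|W| = #|X1| + #|M1| + (#|X2| + (#|M2| + 1)) + (#|O| + #|Y|).
  rewrite /W card_disjU ?c4; last first.
    move=> w + /U3c /negP[]; rewrite in_setU => /orP[/U1S /SC' //|/U2c /andP[] //].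
  by rewrite card_disjU ?c1 ?c3 // => w /U1S wS /U2c /andP[_]; rewrite wS.
have -> : #|Y| = 1 + #|N x :\: C| by rewrite cardsU1 !inE e_irr andbF.
rewrite !(card_imset _ next_inj).
have := cardsID C (N x); have := cardsID C (N s).
have := cardsID S (N x :&: C); have := cardsID S (N s :&: C).
rewrite -!setIA (setIidPr SC).
have: #|N s :&: S| <= #|X1|.
  rewrite -(card_imset X1 next_inj); apply/subset_leq_card/subsetP=> w.
  rewrite !inE => /andP[sw wS]; apply/imsetP.
  exists (prev c w); last by rewrite next_prev.
  have ws : w != s by apply: contraTneq sw => ->; rewrite e_irr.
  have pc : prev c w \in c by rewrite mem_prev SC'.
  have pa : prev c w != a by apply: contraNneq ws => pa; rewrite /s -pa next_prev.
  rewrite inE next_prev // sw andbT; apply/andP; split.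
    by apply: contraTT wS => /(nxnS _ pc) /(_ pa); rewrite next_prev.
  by apply: contraTneq wS => pb; rewrite -(next_prev Uc w) pb.
(* The shifts lose at most a from N(s) and a, b from N(x), while x and t are gained. *)
have := cardsD1 a (N s :&: C :\: S); have := cardsD1 a (N x :&: C :\: S).
have := cardsD1 b (N x :&: S).
have eqD (Z : {set T}) v : [set w in Z | w != v] = Z :\ v.
  by apply/setP=> w; rewrite !inE andbC.
rewrite !eqD.
have := degN (ball_refl e 2 s); have := degN dx; have := degN dab; have := kap2 s.
rewrite /O; clear; lia.
Qed.

(** If the successors have a common neighbour, [shift_count] applies, its last hypothesis being
    vacuous as x has no second neighbour on c. Otherwise the three neighbourhoods in [B m] overlap
    at most in b, although an overlap of 2 is forced. *)
Lemma far_attachments v x y a b m :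
    (forall w a1 a2, same_comp v w -> a1 \in c -> a2 \in c ->
       e w a1 -> e w a2 -> a1 = a2) ->
    same_comp v x -> same_comp v y -> a \in c -> b \in c -> a != b ->
    e x a -> e y b ->
  nx a \in ball e 2 m -> b \in ball e 1 m -> False.
Proof.
move=> one vx vy ca cb ab xa yb mna mb.
have xy : same_comp x y by apply: same_comp_trans vy; rewrite same_comp_sym.
have mnb : nx b \in ball e 2 m := ball_edgeS mb (next_edge cyc cb).
have my : y \in ball e 2 m by apply: ball_edgeS mb _; rewrite e_sym.
have [/set0Pn[w]|] := boolP (N (nx a) :&: N (nx b) != set0).
  rewrite !memE => /andP[aw bw]; apply: (shift_count xy ca cb ab xa yb).
    by apply: (edge_ballS aw); apply: ball_edge; rewrite e_sym.
  by move=> z cz xz /eqP[]; apply: one vx cz ca xz xa.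
rewrite negbK => /eqP N0.
have := card_union3 (nbh_ball mna) (nbh_ball mnb) (nbh_ball my).
rewrite N0 cards0.
have: #|(N (nx a) :|: N (nx b)) :&: N y| <= 1.
  rewrite -(cards1 b); apply/subset_leq_card/subsetP=> w.
  rewrite !memE => /andP[abw yw].
  have [cw|cw] := boolP (w \in c); first by apply/eqP; apply: one vy cw cb yw yb.
  have vw := same_comp_edge vy yw cw.
  have yy := same_comp_refl (same_comp_offc vy).
  have nwa := same_comp_next (same_comp_edge xy yw cw) ca xa.
  have nwb := same_comp_next (same_comp_edge yy yw cw) cb yb.
  by case/orP: abw; rewrite e_sym ?(negbTE nwa) ?(negbTE nwb).
by have := degN mna; have := degN mnb; have := degN my; have := kap2 m; clear; lia.
Qed.

(** Suppose there is none. The ball around p stays connected without the attachment a, so [nx a] is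
    joined to p avoiding a, and an edge leaving [Q] on the way reveals a second attachment that is
    too near. *)
Lemma component_two_attachments v a0 : v \notin c -> a0 \in c ->
  exists x a b, [/\ same_comp v x, a \in c, b \in c & [/\ a != b, e x a & e x b]].
Proof.
move=> vc ca0.
case: (boolP [exists x, exists a, exists b,
    [&& same_comp v x, a \in c, b \in c, a != b, e x a & e x b]]).
  by case/existsP=> x /existsP[a /existsP[b /and5P[? ? ? ? /andP[? ?]]]]; exists x, a, b.
move=> none; exfalso.
have one w a1 a2 : same_comp v w -> a1 \in c -> a2 \in c -> e w a1 -> e w a2 -> a1 = a2.
  move=> vw c1 c2 w1 w2; apply: contraNeq none => a12; apply/existsP; exists w.
  by apply/existsP; exists a1; apply/existsP; exists a2; rewrite vw c1 c2 a12 w1.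
have far := far_attachments one.
have [p [a [vp ca pa]]] : exists p a, [/\ same_comp v p, a \in c & e p a].
  have /forall_inP /(_ v (in_setT _)) /forall_inP /(_ a0 (in_setT _)) va := conn.
  have [||u [w [/and3P[_ _ uw] vu nvw]]] := connect_exit (Q := same_comp v) va.
  - exact: same_comp_refl.
  - by apply: contraTN ca0; exact: same_comp_offc.
  exists u, w; split=> //; apply: contraNT nvw => wc; exact: same_comp_edge vu uw wc.
have ana := next_edge cyc ca; set na := nx a in ana.
have vp3 : p \in B p := ball_refl _ _ _.
have pa3 : a \in B p by apply: ball_mono (ball_edge pa).
have pna3 : na \in B p by apply: ball_mono (edge_ballS pa (ball_edge ana)).
have nap : na != a by apply: contraTneq ana => ->; rewrite e_irr.
have pna : p != a by apply: contraTneq pa => ->; rewrite e_irr.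
have na1 : na \in ball e 1 a := ball_edge ana.
have /forall_inP /(_ na) := connB pa3; rewrite in_setD1 nap pna3 => /(_ isT).
move=> /forall_inP /(_ p); rewrite in_setD1 pna vp3 => /(_ isT) na_p.
pose Q u := (u \in ball e 2 a) && ~~ same_comp v u.
have Qna : Q na.
  rewrite /Q (ball_mono _ na1) //=; apply: contraTN ca => /same_comp_offc.
  by rewrite mem_next.
have nQp : ~~ Q p by rewrite /Q vp andbF.
have [u [u' [/and3P[]]]] := connect_exit na_p Qna nQp.
rewrite !in_setD1 => /andP[ua _] /andP[ua' pu'] uu' /andP[au2 nvu] nQu'.
have [x ax xu] : exists2 x, x \in ball e 1 a & e x u.
  by have [ua0|//] := ballSrP e_sym au2; rewrite ua0 eqxx in ua.
have xna : na \in ball e 2 x by apply: (ball_trans (r := 1)) na1; rewrite ball_sym.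
have off_c w w' : same_comp v w -> e w w' -> ~~ same_comp v w' -> w' \in c.
  by move=> vw ww'; apply: contraNT => w'c; exact: same_comp_edge vw ww' w'c.
(* If u' is in the component, u itself is an attachment at distance at most 2 from a. *)
case: (boolP (same_comp v u')) => vu'.
  have cu : u \in c by apply: off_c vu' _ nvu; rewrite e_sym.
  apply: (far p u' a u x) => //; rewrite 1?eq_sym //; first by rewrite e_sym.
  exact: ball_edge.
have nau' : u' \notin ball e 2 a by apply: contraNN nQu' => au'; rewrite /Q au'.
(* Now u' is beyond distance 2 from a but within 3 of p: a short walk from p to u' leaves the
   component at an attachment b other than a. *)
have [y [b [vy cb ab yb bu']]] : exists y b,
    [/\ same_comp v y, b \in c, a != b, e y b & u' \in ball e 1 b].
  have [u'p|[g pg gu']] := ballSP pu'; first by rewrite u'p vp in vu'.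
  have vg : same_comp v g.
    apply: contraNT nau' => /(off_c _ _ vp pg) cg.
    by rewrite -(one p a g vp ca cg pa pg) in gu'.
  have [u'g|[h gh hu']] := ballSP gu'; first by rewrite u'g vg in vu'.
  case: (boolP (same_comp v h)) => [vh|/(off_c _ _ vg gh) ch].
    have [u'h|hu] := ball1P hu'; first by rewrite u'h vh in vu'.
    exists h, u'; rewrite (off_c h) // eq_sym; split=> //; exact: ball_refl.
  exists g, h; split=> //; apply: contraNneq nau' => ->; exact: ball_mono hu'.
(* [be] stands in for the successor of b in a count in [B x], where [nx b] may be too far away. *)
have [be [bb vb ba xb]] : exists be,
    [/\ e be b, ~~ same_comp v be, be != a & be \in ball e 2 x].
  have [u'b|bu'e] := ball1P bu'.
    by exists u; rewrite -u'b; split=> //; apply: ball_mono (ball_edge xu).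
  by exists u'; rewrite e_sym; split=> //; apply: edge_ballS xu (ball_edge _).
have nfar m : na \in ball e 2 m -> b \in ball e 1 m -> False.
  by apply: far vp vy ca cb ab pa yb.
have be_b := ball_edge bb.
have xp : p \in ball e 2 x.
  by apply: (ball_trans (r := 1) (v := a)); rewrite 1?ball_sym //; apply: ball_edge.
have := card_union3 (nbh_ball xna) (nbh_ball xb) (nbh_ball xp).
have -> : #|N na :&: N be| = 0.
  apply/eqP; rewrite cards_eq0; apply/eqP/setP=> w; rewrite !memE.
  apply/negP=> /andP[aw bw]; apply: nfar be_b.
  by apply: (edge_ballS bw); apply: ball_edge; rewrite e_sym.
have: #|(N na :|: N be) :&: N p| <= 1.
  rewrite -(cards1 a); apply/subset_leq_card/subsetP=> w; rewrite !memE.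
  case/andP=> abw pw; apply: contraT => wa.
  have vw : same_comp v w.
    apply: contraNT wa => /(off_c _ _ vp pw) cw; apply/eqP.
    exact: one vp cw ca pw pa.
  case/orP: abw => [aw|bw].
    have pw' : same_comp p w by apply: same_comp_trans vw; rewrite same_comp_sym.
    by have := same_comp_next pw' ca pa; rewrite e_sym aw.
  have wb : e w be by rewrite e_sym.
  have cbe := off_c _ _ vw wb vb.
  exfalso; apply: (far w y be b be) => //.
    by apply: contraTneq bb => ->; rewrite e_irr.
  exact: ball_mono (ball_edge (next_edge cyc cbe)).
by have := degN xna; have := degN xb; have := degN xp; have := kap2 x; clear; lia.
Qed.

(** If no such chord existed, [shift_count] would apply with y = x. *)
Lemma exchange_exists x a b : x \notin c -> a \in c -> b \in c -> a != b ->
    e x a -> e x b ->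
  exists z b', [/\ z \in c, b' \in c, e x z, e x b'
                 & z != b' /\ e (nx (nx z)) (nx b')].
Proof.
move=> xc ca cb ab xa xb.
case: (boolP [exists z, exists b',
    [&& z \in c, b' \in c, e x z, e x b', z != b' & e (nx (nx z)) (nx b')]]).
  by case/existsP=> z /existsP[b' /and5P[? ? ? ? /andP[? ?]]]; exists z, b'.
move=> none; exfalso; have xx := same_comp_refl xc.
apply: (shift_count xx ca cb ab xa xb) => [|z cz xz za zb].
  exact: next_ball2 xc _ _ xa xb.
have H b' : b' \in c -> e x b' -> z != b' -> ~~ e (nx b') (nx (nx z)).
  move=> cb' xb' zb'; apply: contraNN none => ez; apply/existsP; exists z.
  by apply/existsP; exists b'; rewrite cz cb' xz xb' zb' e_sym.
by split; [exact: next_ball2 xc _ _ xa xz | exact: H | exact: H].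
Qed.

End FixedCycle.

(** * Vertices off a longest cycle are pairwise nonadjacent *)

(** Induction on a bound for the size of the component. It turns the component into a star around
    any vertex with two neighbours on c; a leaf y again has two, so x and y have only each other off
    c. *)
Lemma no_off_edge k c v v' :
    ucycle e c -> (forall c' : seq T, ucycle e c' -> size c' <= size c) ->
    0 < size c -> v \notin c -> v' \notin c -> e v v' ->
  #|[set w | same_comp c v w]| <= k -> False.
Proof.
elim: k => [|k IHk] in c v v' *.
  move=> _ _ _ vc _ _; rewrite leqn0 cards_eq0 => /eqP /setP /(_ v).
  by rewrite in_set0 inE same_comp_refl.
move=> cyc cmax c0 vc v'c vv' szK.
have [a0 ca0] : exists a0, a0 \in c.
  by case: (c) c0 => // a0 r _; exists a0; rewrite mem_head.
(* Exchanging x with the successor of an attachment gives another longest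
   cycle, off which K splits into components of K - x. *)
have star x a b : same_comp c v x -> a \in c -> b \in c -> a != b ->
    e x a -> e x b -> forall y y', same_comp c x y -> same_comp c x y' ->
    y != x -> y' != x -> ~~ e y y'.
  move=> vx ca cb ab xa xb y y' xy xy' yx y'x; apply/negP=> yy'.
  have /andP[xc _] := xy; have xx := same_comp_refl xc.
  have [z [b' [cz cb' xz xb' [zb' zz]]]] := exchange_exists cyc cmax xc ca cb ab xa xb.
  have offx : offpath e c x [::] by rewrite /offpath /= xc.
  have [c1 [cyc1 sz1 mem1]] := cycle_exchange e_sym cyc offx cz cb' zb' xb' xz
    (same_comp_next cyc cmax xx cz xz) zz.
  rewrite addn0 in sz1.
  have nc1 w : same_comp c x w -> w != x -> w \notin c1.
    by move=> xw wx; rewrite mem1 inE negb_or wx negb_and (same_comp_offc xw).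
  apply: (IHk c1 y y' cyc1) => //; rewrite ?sz1 // ?nc1 //.
  rewrite -ltnS; apply: leq_trans szK; apply: proper_card; apply/properP; split.
    apply/subsetP=> w; rewrite !inE => /andP[yc1 yw].
    pose Q w := same_comp c x w && (w != x).
    suff: Q w by case/andP=> xw _; exact: same_comp_trans vx xw.
    apply: contraT => nQw; have Qy : Q y by rewrite /Q xy.
    (* The only vertex of c off [c1] is [next c z], and it has no neighbour in the old component. *)
    have [u [u' []]] := connect_exit yw Qy nQw.
    rewrite offE => /and3P[uc1 u'c1 uu'] /andP[xu ux] nQu'.
    move: u'c1 nQu'; rewrite mem1 inE negb_or negb_and negbK /Q.
    case/andP=> u'x /orP[u'c|/eqP u'z].
      by rewrite (same_comp_edge xu uu' u'c) u'x.
    by have := same_comp_next cyc cmax xu cz xz; rewrite -u'z uu'.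
  exists x; rewrite inE //; apply/negP=> /same_comp_offc.
  by rewrite mem1 inE eqxx.
have [x [a [b [vx ca cb [ab xa xb]]]]] := component_two_attachments cyc cmax vc ca0.
have xc := same_comp_offc vx; have xx := same_comp_refl xc.
have starx := star x a b vx ca cb ab xa xb.
have xv : same_comp c x v by rewrite same_comp_sym.
have xv' : same_comp c x v' := same_comp_edge xv vv' v'c.
have [y [xy yc yx]] : exists y, [/\ e x y, y \notin c & y != x].
  have [vx0|nvx] := eqVneq v x.
    exists v'; rewrite -vx0 v'c vv'; split=> //.
    by apply: contraTneq vv' => ->; rewrite e_irr.
  have [v'x0|nv'x] := eqVneq v' x.
    by exists v; rewrite -v'x0 e_sym vv' vc v'x0.
  by have := starx v v' xv xv' nvx nv'x; rewrite vv'.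
have cxy : same_comp c x y := same_comp_edge xx xy yc.
have Ny w : e y w -> w \notin c -> w = x.
  move=> yw wc; have xw := same_comp_edge cxy yw wc.
  by apply/eqP; apply: contraTT yw => wx; exact: starx cxy xw yx wx.
have NyC : #|N y :\: [set z in c]| <= 1.
  rewrite -(cards1 x); apply/subset_leq_card/subsetP=> w.
  by rewrite in_setD !inE => /andP[wc yw]; apply/eqP; exact: Ny.
have yx_edge : e y x by rewrite e_sym.
have ana := next_edge cyc ca.
(* Five vertices and connectivity at least 2 give d(y) >= 3, hence two neighbours of y on c besides
   x. *)
have szB : 5 <= #|B y|.
  have Ul : uniq [:: x; y; a; b; next c a].
    have nc w : w \in c -> (w != x) && (w != y).
      by move=> cw; apply/andP; split; apply: contraTneq cw => ->.
    have nac : next c a \in c by rewrite mem_next.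
    have nab : next c a != b.
      by apply: contraTneq xb => <-; exact: (same_comp_next cyc cmax xx ca xa).
    have naa : next c a != a by apply: contraTneq ana => ->; rewrite e_irr.
    have /andP[? ?] := nc a ca; have /andP[? ?] := nc b cb.
    have /andP[? ?] := nc _ nac.
    rewrite /= !inE !negb_or -!andbA.
    by do ?[apply/andP; split]; rewrite // eq_sym.
  rewrite -[5]/(size [:: x; y; a; b; next c a]) cardE; apply: uniq_leq_size Ul _.
  have a2 : a \in ball e 2 y := edge_ballS yx_edge (ball_edge xa).
  move=> w; rewrite mem_enum !in_cons orbF => /or4P[/eqP->|/eqP->|/eqP->|].
  - by apply: ball_mono (ball_edge yx_edge).
  - exact: ball_refl.
  - exact: ball_mono a2.
  case/orP=> /eqP->; first by apply: ball_mono (edge_ballS yx_edge (ball_edge xb)).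
  exact: ball_edgeS a2 ana.
have [a1 [b1 [ca1 cb1 [ab1 ya1 yb1]]]] : exists a1 b1,
    [/\ a1 \in c, b1 \in c & [/\ a1 != b1, e y a1 & e y b1]].
  have /card_gt1P[a1 [b1 []]] : 1 < #|N y :&: [set z in c]|.
    have := cardsID [set z in c] (N y); have := degN (ball_refl e 2 y); have := kap2 y.
    by move: NyC szB; clear; lia.
  by rewrite !inE => /andP[? ?] /andP[? ?] ?; exists a1, b1.
have vy : same_comp c v y := same_comp_trans vx cxy.
have cyx : same_comp c y x by rewrite same_comp_sym.
have cyy := same_comp_refl yc.
have Nx w : e x w -> w \notin c -> w = y.
  move=> xw wc; have yw := same_comp_edge cyx xw wc.
  apply/eqP; apply: contraTT xw => wy.
  by apply: (star y a1 b1) => //; rewrite eq_sym.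
have na2 : next c a \in ball e 2 x := edge_ballS xa (ball_edge ana).
have dx := degN (ball_refl e 2 x); have dna := degN na2.
have dy : #|B x| + kap x <= 3 * #|N y| by apply: degN; apply: ball_mono (ball_edge xy).
(* With two common neighbours on c, [shift_count] applies: a forbidden chord would now allow a cycle
   with one more vertex, using both x and y. *)
have [/card_gt1P[a2 [b2 []]]|few] := ltnP 1 #|N x :&: N y :&: [set z in c]|.
  rewrite !inE => /andP[/andP[xa2 ya2] ca2] /andP[/andP[xb2 yb2] cb2] ab2.
  apply: (shift_count cyc cmax cxy ca2 cb2 ab2 xa2 yb2).
    exact: (next_ball2 cyc cmax xc ca2 cb2 xa2 xb2).
  have nolong z b' : z \in c -> b' \in c -> z != b' -> e x z -> e y b' ->
      ~~ e (next c b') (next c (next c z)).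
    move=> cz cb' zb' xz yb'; apply/negP; rewrite e_sym => zz.
    have offyx : offpath e c y [:: x].
      by rewrite /offpath /= yx_edge xc yc inE yx.
    have [c1 [cyc1 sz1 _]] := cycle_exchange e_sym cyc offyx cz cb' zb' yb' xz
      (same_comp_next cyc cmax cxy cz xz) zz.
    by have := cmax _ cyc1; rewrite sz1 addn1 ltnn.
  move=> z cz xz za zb; split; [|exact: nolong|exact: nolong].
  exact: (next_ball2 cyc cmax xc ca2 cz xa2 xz).
(* Otherwise the two successor sets share at most x, y and one successor. Their union avoids the
   neighbourhood of [next c a], which overfills [B x]. *)
have sub : succ_set c x :|: succ_set c y \subset B x.
  apply/subsetP=> w; rewrite in_setU => /orP[] /(subsetP (succ_set_ball cyc _)) xw.
    exact: ball_mono xw.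
  exact: edge_ballS xy xw.
have sI : #|succ_set c x :&: succ_set c y| <= 3.
  have : #|next c @: (N x :&: N y :&: [set z in c]) :|: [set x; y]| <= 3.
    rewrite (leq_trans (leq_card_setU _ _)) // (card_imset _ (next_inj cyc)) cards2.
    by move: few; clear; case: (x != y); lia.
  apply: leq_trans; apply/subset_leq_card/subsetP=> w.
  rewrite in_setI /succ_set !in_setU => /andP[].
  case/orP=> [/imsetP[z1]|xw].
    rewrite in_setI inE nbhE => /andP[xz1 cz1] ->.
    rewrite !in_set1 in_setD !inE mem_next cz1 /= orbF => /orP[/imsetP[z2]|/eqP yz].
      rewrite !inE => /andP[yz2 _] /(next_inj cyc) z12; apply/orP; left.
      by apply: imset_f; rewrite !inE xz1 cz1 z12 yz2.
    by rewrite -yz mem_next cz1 in yc.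
  move=> _; apply/orP; right; move: xw; rewrite !inE => /orP[->//|/andP[wc xw]].
  by rewrite (Nx w xw wc) eqxx orbT.
have cU := cardsUI (succ_set c x) (succ_set c y).
have sna : #|N (next c a) :&: (succ_set c x :|: succ_set c y)| = 0.
  by rewrite setIUr (succ_set_nbh cyc cmax xx) // (succ_set_nbh cyc cmax cxy) //
     setU0 cards0.
have := card_union3 (nbh_ball na2) sub (sub0set _); rewrite sna setI0 !cards0.
move: cU sI; rewrite !(card_succ_set cyc) //; have := kap2 x; move: dx dy dna.
clear; lia.
Qed.

(** * An independent set against a minimum cut *)

(** The cycle no longer appears. In each count [I] acts as a copy of N(x) with one vertex to spare,
    disjoint from the neighbourhood of each of its members. *)
Lemma no_independent_star x (I : {set T}) : x \in I -> #|I| = #|N x|.+1 ->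
    (forall i, i \in I -> N i :&: I = set0) ->
    (forall i j, i \in I -> j \in I -> j \in ball e 2 i) ->
  False.
Proof.
move=> xI cardI indep ballI.
have ballI3 i : i \in I -> I \subset B i.
  by move=> iI; apply/subsetP=> j /(ballI i j iI); apply: ball_mono.
have capNU i (y : T) : i \in I -> y \notin I ->
    (N i :|: (y |: N y)) :&: I = N y :&: I.
  move=> iI yI; rewrite !setIUl (indep i iI) set0U.
  suff -> : [set y] :&: I = set0 by rewrite set0U.
  by apply/setP=> w; rewrite !inE; case: eqP => // ->; rewrite (negbTE yI).
have card_closed (y : T) : #|y |: N y| = #|N y|.+1.
  by rewrite cardsU1 nbhE e_irr.
have closed_ball r v (y : T) : y \in ball e r v -> y |: N y \subset ball e r.+1 v.
  move=> vy; rewrite subUset sub1set nbh_ball // andbT; exact: ball_mono vy.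
have disj_far i (y : T) : y \notin ball e 2 i -> N i :&: (y |: N y) = set0.
  move=> niy; apply/setP=> w; rewrite !(in_setI, in_setU1, nbhE, in_set0).
  apply/negP=> /andP[iw /orP[/eqP wy|yw]]; case/negP: niy.
    by rewrite -wy; apply: ball_mono (ball_edge iw).
  by apply: (edge_ballS iw); apply: ball_edge; rewrite e_sym.
have ball_notI i (y : T) : i \in I -> y \notin ball e 2 i -> y \notin I.
  by move=> iI; apply: contraNN => /(ballI i y iI).
(* Count N(m2), the closed neighbourhood of y and [I] in [B m1]; the 2 comes from y itself and the
   spare vertex of [I]. *)
have far_near m1 m2 (y : T) : m1 \in I -> m2 \in I -> y \in ball e 2 m1 ->
    y \notin ball e 2 m2 -> kap m1 + 2 <= #|N y :&: I|.
  move=> I1 I2 y1 y2.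
  have m12 : m2 \in ball e 2 m1 := ballI _ _ I1 I2.
  have := card_union3 (nbh_ball m12) (closed_ball _ _ _ y1) (ballI3 m1 I1).
  rewrite disj_far // cards0 capNU ?(ball_notI m2) // card_closed cardI.
  have := degN m12; have := degN y1; have := degN (ballI _ _ I1 xI).
  clear; lia.
case: (arg_minnP (fun i => kap i) xI) => m mI minm.
have [S cardS [SB cutS]] := kappa_cut e (B m).
have dm := degN (ball_refl e 2 m); have dx := degN (ballI _ _ mI xI).
have sub3 := card_union3 (ballI3 m mI) (nbh_ball (ball_refl e 2 m)) (sub0set _).
rewrite setIC indep // setI0 !cards0 cardI in sub3.
(* From d(x)+1+d(m) <= n the degree bounds give n >= 2k+3 and d(x) > k: the cut really disconnects,
   and it cannot contain [I]. *)
have kapI : kap m < #|N x| /\ (kap m).+1 < #|B m|.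
  by move: dm dx sub3; clear; split; lia.
case: cutS => [ncon|]; last by rewrite leqNgt kapI.2.
have [u uI uS] : exists2 u, u \in I & u \notin S.
  apply/subsetPn; apply/negP=> /subset_leq_card; rewrite cardI cardS; move: kapI.1.
  by clear; lia.
have uB : u \in B m := subsetP (ballI3 m mI) u uI.
pose r := induced e (B m :\: S); pose H := connect r u.
have rE w z : r w z = [&& w \in B m :\: S, z \in B m :\: S & e w z] by [].
have symr : connect_sym r.
  by apply: sym_connect_sym => w z; rewrite !rE e_sym andbCA.
have [y0 y0BS ny0] : exists2 y, y \in B m :\: S & ~~ H y.
  have uBS : u \in B m :\: S by rewrite in_setD uS.
  move: ncon; rewrite negb_forall_in => /existsP[w /andP[wBS]].
  rewrite negb_forall_in => /existsP[z /andP[zBS nwz]].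
  have [Hw|] := boolP (H w); last by exists w.
  exists z => //; apply: contraNN nwz => Hz; apply: connect_trans Hz.
  by rewrite symr.
have HBS w : H w -> w \in B m :\: S.
  move=> Hw; apply: contraT => nw.
  have uBS : u \in B m :\: S by rewrite in_setD uS.
  have [u1 [w1 [/and3P[_ w1B _] _]]] :=
    connect_exit (Q := fun z => z \in B m :\: S) Hw uBS nw.
  by rewrite w1B.
have Hedge w z : H w -> z \in B m :\: S -> e w z -> H z.
  move=> Hw zBS wz; apply: (connect_trans Hw); apply: connect1.
  by rewrite rE zBS wz (HBS w Hw).
(* N(u), [I] and N(z) total more than n+k, but N(z) can meet the other two only in [S], as z lies
   outside the component [H]. *)
have core z : z \in ball e 2 m -> z \in B m :\: S -> ~~ H z ->
    z \in I \/ (forall i, i \in I -> i \notin S -> H i) -> False.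
  move=> mz zBS nHz zI.
  have mu : u \in ball e 2 m := ballI _ _ mI uI.
  have := card_union3 (nbh_ball mu) (ballI3 m mI) (nbh_ball mz).
  rewrite indep // cards0.
  have: #|(N u :|: I) :&: N z| <= kap m.
    rewrite -cardS; apply/subset_leq_card/subsetP=> w.
    rewrite in_setI in_setU !nbhE => /andP[uw zw]; apply: contraT => wS.
    have wB : w \in B m by apply: ball_edgeS mz zw.
    have wBS : w \in B m :\: S by rewrite in_setD wS.
    case/negP: nHz; apply: (Hedge w z _ zBS); last by rewrite e_sym.
    case/orP: uw => [uw|wI]; first by exact: (Hedge u w (connect0 _ _) wBS uw).
    case: zI => [zI|]; last exact.
    by have /setP/(_ w) := indep z zI; rewrite !inE zw wI.
  move: (degN mu) (degN mz) dx; rewrite cardI; clear; lia.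
have IH i : i \in I -> i \notin S -> H i.
  move=> iI iS; apply: contraT => nHi; exfalso.
  apply: (core i) nHi (or_introl iI); first exact: ballI.
  by rewrite in_setD iS (subsetP (ballI3 m mI)).
have out_far y : y \in B m :\: S -> ~~ H y -> y \notin ball e 2 m.
  by move=> yBS nHy; apply/negP=> my; apply: (core y) => //; right.
(* A neighbour i in [I] would give y0 at least [kap i + 2] neighbours in [I], all of them in [S],
   against the minimality of [kap m]. *)
have NyI : N y0 :&: I = set0.
  apply/eqP; apply: contraT => /set0Pn[i]; rewrite in_setI nbhE => /andP[yi iI].
  have iy : y0 \in ball e 2 i.
    by apply: ball_mono (ball_edge _) => //; rewrite e_sym.
  have := far_near i m y0 iI mI iy (out_far _ y0BS ny0).
  have : #|N y0 :&: I| <= kap m.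
    rewrite -cardS; apply/subset_leq_card/subsetP=> w.
    rewrite in_setI nbhE => /andP[yw wI]; apply: contraT => wS.
    by case/negP: ny0; apply: (Hedge w y0 (IH w wI wS) y0BS); rewrite e_sym.
  by have := minm i iI; clear; lia.
have yfar i : i \in I -> y0 \notin ball e 2 i.
  move=> iI; apply/negP=> iy; have := far_near i m y0 iI mI iy (out_far _ y0BS ny0).
  by rewrite NyI cards0 addn2.
have y3 : y0 \in B m by move: y0BS; rewrite in_setD => /andP[].
have [y0m|[h mh hy]] := ballSrP e_sym y3.
  by have := yfar m mI; rewrite y0m ball_refl.
have NhI : N h :&: I = set0.
  apply/eqP; apply: contraT => /set0Pn[i]; rewrite in_setI nbhE => /andP[hi iI].
  have /negP[] := yfar i iI.
  by apply: (edge_ballS (v := h)) (ball_edge hy); rewrite e_sym.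
have xh : h \in ball e 2 x.
  apply: contraT => nxh; have := far_near m x h mI xI mh nxh.
  by rewrite NhI cards0 addn2.
have xy : y0 \in B x := ball_edgeS xh hy.
have [y0x|[a xa ay]] := ballSP xy.
  by have := yfar x xI; rewrite y0x ball_refl.
have ax : x \in ball e 2 a.
  by apply: ball_mono (ball_edge _) => //; rewrite e_sym.
(* Around a, a neighbour of x within distance 2 of y0, the sets N(x), [I] and the closed
   neighbourhood of y0 are pairwise disjoint, which is too much for [B a]. *)
have Ia : I \subset B a.
  by apply/subsetP=> i /(ballI x i xI); apply: edge_ballS; rewrite e_sym.
have := card_union3 (nbh_ball ax) (closed_ball _ _ _ ay) Ia.
rewrite disj_far ?yfar // capNU ?(ball_notI x) ?yfar // NyI cards0 card_closed cardI.
by have := degN ax; have := degN ay; clear; lia.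
Qed.

(** * A longest cycle exists and spans *)

Lemma longest_cycle_spanning c :
    ucycle e c -> (forall c' : seq T, ucycle e c' -> size c' <= size c) ->
    0 < size c -> forall x, x \in c.
Proof.
move=> cyc cmax c0 x; apply: contraT => xc; exfalso.
have off_indep v w : v \notin c -> w \notin c -> ~~ e v w.
  move=> vc wc; apply/negP=> vw.
  exact: (no_off_edge cyc cmax c0 vc wc vw (leqnn _)).
have xx := same_comp_refl xc.
have xN w : e x w -> w \in c.
  by move=> xw; apply: contraTT xw; exact: off_indep xc.
have memI i : i \in succ_set c x -> i = x \/ exists2 a, e x a & i = next c a.
  rewrite !in_setU in_set1 in_setD !inE => /or3P[/imsetP[a]|/eqP->|/andP[ic /xN]].
  - by rewrite !inE => /andP[xa _] ->; right; exists a.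
  - by left.
  by rewrite (negbTE ic).
have xI : x \in succ_set c x by rewrite !inE eqxx orbT.
apply: (no_independent_star xI (card_succ_set cyc xc)) => [i /memI[->|[a xa ->]]|i j].
- apply/setP=> w; rewrite !inE; apply/negP=> /andP[xw].
  have wc := xN w xw; rewrite wc /= orbF => /orP[/imsetP[z]|/eqP wx].
    rewrite !inE => /andP[xz zc] wz.
    by have := same_comp_next cyc cmax xx zc xz; rewrite -wz xw.
  by rewrite -wx wc in xc.
- by apply: (succ_set_nbh cyc cmax xx) => //; exact: xN.
move=> /memI[->|[a xa ->]] /memI[->|[b xb ->]].
- exact: ball_refl.
- exact: edge_ballS xb (ball_edge (next_edge cyc (xN b xb))).
- by rewrite ball_sym //; exact: edge_ballS xa (ball_edge (next_edge cyc (xN a xa))).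
by apply: (next_ball2 cyc cmax xc) => //; exact: xN.
Qed.

End LocalDegree.

Lemma exists_longest_cycle (T : finType) (e : rel T) :
  exists2 c, ucycle e c & forall c' : seq T, ucycle e c' -> size c' <= size c.
Proof.
pose P n := [exists c : n.-tuple T, cycle e c && uniq c].
have PT n : P n -> n <= #|T|.
  case/existsP=> c /andP[_ Uc]; rewrite -(size_tuple c) -(card_uniqP Uc).
  exact: max_card.
have P0 : exists n, P n by exists 0; apply/existsP; exists [tuple].
case: (ex_maxnP P0 PT) => n /existsP[c cyc] nmax.
exists (val c) => // c' cyc'; rewrite size_tuple; apply: nmax.
by apply/existsP; exists (in_tuple c').
Qed.

Theorem theorem12 (T : finType) (e : rel T)
    (e_sym : symmetric e) (e_irr : irreflexive e)
    (G_conn : connected e [set: T]) (G_card : 3 <= #|T|)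
    (balls_2conn : forall v : T, k_connected e 2 (ball e 3 v))
    (degree_ge : forall v u : T, interior e 3 v u ->
       ((1 / 3%:R) * (#|ball e 3 v| + kappa e (ball e 3 v))%:R
          <= (degree e u)%:R :> rat)%R) :
  hamiltonian e.
Proof.
have degN m u : u \in ball e 2 m ->
    #|ball e 3 m| + kappa e (ball e 3 m) <= 3 * #|nbh e u|.
  move/interior_ball2/degree_ge; rewrite GRing.mul1r GRing.mulrC.
  rewrite Num.Theory.ler_pdivrMr // -GRing.natrM Num.Theory.ler_nat.
  by rewrite mulnC.
have [c cyc cmax] := exists_longest_cycle e.
(* [ucycle] admits the two ends of an edge as a cycle, which suffices here; length at least 3
   follows at the end from spanning. *)
have c_gt0 : 0 < size c.
  have [v _] : exists v : T, v \in T by apply/card_gt0P; apply: leq_trans G_card.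
  have /card_gt0P[w] : 0 < #|nbh e v|.
    have := degN v v (ball_refl e 2 v); have := balls_2conn v.
    by rewrite /k_connected; clear; lia.
  rewrite nbhE => vw; apply: leq_trans (cmax [:: v; w] _) => //.
  have vw_neq : v != w by apply: contraTneq vw => ->; rewrite e_irr.
  by rewrite /ucycle /= inE vw_neq vw (e_sym w v) vw.
have span := longest_cycle_spanning e_sym e_irr balls_2conn degN G_conn
  (fun m w => connected_setD1 (balls_2conn m)) cyc cmax c_gt0.
exists c; split=> //; apply: leq_trans G_card _.
by apply: leq_trans (card_size c); apply/subset_leq_card/subsetP=> x _.
Qed.
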